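(* Let $R=(r_1,r_2,\ldots,r_n)$ be a nondecreasing vector of nonnegative integers satisfying $r_i+r_{n+1-i}=n-1$ for $i=1,2,\ldots,n$ and $\sum_{i=1}^k r_i\ge\binom{k}{2}$ for $k=1,2,\ldots,n$, with equality for $k=n$. Then the Hankel algorithm (defined in the context) applied to $R$ constructs a Hankel tournament with score vector $R$, i.e. a matrix in $\mathcal{T}_H(R)$.
   Context: A tournament of order $n$ is an $n\times n$ $(0,1)$-matrix $T=[t_{ij}]$ with $t_{ii}=0$ and $t_{ij}=1-t_{ji}$ for $i\ne j$; its score vector is the vector of its row sums. For an $m\times m$ matrix $A=[a_{ij}]$, $A^t$ is the transpose and $A^h$ is the Hankel transpose, with $(i,j)$ entry $a_{m+1-j,m+1-i}$. A Hankel tournament is a tournament $T$ with $T^h=T$. $\mathcal{T}_H(R)$ is the set of Hankel tournaments with score vector $R$. $J_m$ is the $m\times m$ all-ones matrix. Hankel algorithm (recursive; the order-$0$ output is the empty matrix). Input: a nondecreasing vector $R=(r_1,\ldots,r_n)$ of nonnegative integers with $r_i+r_{n+1-i}=n-1$ for all $i$ and $\sum_{i=1}^k r_i\ge\binom{k}{2}$ for all $k$, with equality for $k=n$. (1) If $n$ is even: (a) Let $v=(v_1,\ldots,v_n)=(0,\ldots,0,1,\ldots,1,0)$, consisting of $n-r_1-1$ zeros, followed by $r_1$ ones, followed by a single $0$. Let $R'_{n-2}=(r'_1,\ldots,r'_{n-2})$ with $r'_i=r_{i+1}-v_{i+1}-(1-v_{n-i})$ for $1\le i\le n-2$. (b)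 Let $Q_{n-2}$ be an $(n-2)\times(n-2)$ permutation matrix that corresponds to a composition of interchanges of complementary indices $i\leftrightarrow (n-2)+1-i$ and simultaneous double interchanges $i\leftrightarrow j$, $(n-2)+1-i\leftrightarrow(n-2)+1-j$, such that $R_{n-2}=R'_{n-2}Q_{n-2}^t$ is nondecreasing. (c) Let $T_{n-2}$ be the matrix obtained by this algorithm applied to $R_{n-2}$. (d) Let $T_n$ be the $n\times n$ matrix whose first row is $(0,v_{n-1},\ldots,v_2,v_1)$, whose first column is $(0,1-v_{n-1},\ldots,1-v_2,1-v_1)^t$, whose last column is $(v_1,v_2,\ldots,v_{n-1},0)^t$, whose last row is $(1-v_1,1-v_2,\ldots,1-v_{n-1},0)$, and whose central $(n-2)\times(n-2)$ submatrix (rows and columns $2,\ldots,n-1$) is $Q_{n-2}^tT_{n-2}Q_{n-2}$. (2) If $n$ is odd: (a) Let $R'_{n-1}=(r'_1,\ldots,r'_{n-1})$ with $r'_i=r_i$ if $1\le i\le\frac{n-1}{2}$ and $r'_i=r_{i+1}-1$ if $\frac{n+1}{2}\le i\le n-1$. (b) Let $Q_{n-1}$ be an $(n-1)\times(n-1)$ permutation matrix of the type in (1)(b) (with $n-1$ in place of $n-2$) such that $R_{n-1}=R'_{n-1}Q_{n-1}^t$ is nondecreasing. (c) Let $T_{n-1}$ be obtained by this algorithm applied to $R_{n-1}$, and write $T'_{n-1}=Q_{n-1}^tT_{n-1}Q_{n-1}=\left[\begin{array}{cc}A&B\\ J_{(n-1)/2}-B^t&A^h\end{array}\right]$ with $\frac{n-1}{2}\times\frac{n-1}{2}$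 blocks. (d) Let $T_n$ be obtained from $T'_{n-1}$ by inserting a new middle row and middle column (index $\frac{n+1}{2}$): the middle row is $\frac{n-1}{2}$ ones followed by $\frac{n+1}{2}$ zeros, and the middle column is $\frac{n+1}{2}$ zeros followed by $\frac{n-1}{2}$ ones. (3) Output $T_n$. *)

(* Defs.v *)
From HB Require Import structures.
From mathcomp Require Import all_boot all_order all_algebra all_fingroup.

Set Implicit Arguments.
Unset Strict Implicit.
Unset Printing Implicit Defensive.

Import Order.TTheory GRing.Theory Num.Theory.
Local Open Scope ring_scope.

(* Integer vectors are used instead of natural-number vectors so that the
   subtractions performed by the algorithm are not truncated.  All indices are
   0-based: [rev_ord i] is the index complementary to [i]. *)

Definition tournament (n : nat) (T : 'M[int]_n) : Prop :=
  [/\ forall i j, T i j \in [:: 0; 1],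
      forall i, T i i = 0
    & forall i j, i != j -> T i j = 1 - T j i].

Definition score (n : nat) (T : 'M[int]_n) : 'rV[int]_n :=
  \row_i \sum_j T i j.

Definition hankel_tr (n : nat) (A : 'M[int]_n) : 'M[int]_n :=
  \matrix_(i, j) A (rev_ord j) (rev_ord i).

Definition hankel_tournament (n : nat) (T : 'M[int]_n) : Prop :=
  tournament T /\ hankel_tr T = T.

Definition hankel_class (n : nat) (R : 'rV[int]_n) (T : 'M[int]_n) : Prop :=
  hankel_tournament T /\ score T = R.

Definition nondecreasing_vec (n : nat) (R : 'rV[int]_n) : Prop :=
  forall i j : 'I_n, (i <= j)%N -> R 0 i <= R 0 j.

Definition hankel_input (n : nat) (R : 'rV[int]_n) : Prop :=
  [/\ forall i, 0 <= R 0 i,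
      nondecreasing_vec R,
      forall i, R 0 i + R 0 (rev_ord i) = n%:Z - 1,
      forall k, (1 <= k <= n)%N -> 'C(k, 2)%:Z <= \sum_(i < n | (i < k)%N) R 0 i
    & \sum_(i < n) R 0 i = 'C(n, 2)%:Z].

Definition hankel_interchanges (m : nat) : {set 'S_m} :=
  [set tperm i (rev_ord i) | i : 'I_m] :|:
  [set (tperm ij.1 ij.2 * tperm (rev_ord ij.1) (rev_ord ij.2))%g
     | ij : 'I_m * 'I_m].

(* Every generator is an involution, so the generated group is exactly the set
   of finite compositions of interchanges. *)
Definition sorting_perm (m : nat) (R' : 'rV[int]_m) (q : 'S_m) : Prop :=
  q \in <<hankel_interchanges m>>%g /\
  nondecreasing_vec (R' *m (perm_mx q)^T).

Section EvenStep.
Variables (n : nat) (R : 'rV[int]_n.+2).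

(* With N = n.+2: N - r_1 - 1 zeros, then r_1 ones, then a single 0. *)
Definition even_v (i : 'I_n.+2) : int :=
  ((n.+1%:Z - R 0 ord0 <= i%:Z) && (i < n.+1)%N)%:R.

(* [inner] embeds the central indices, [inner i = i.+1]; [inner_inv] is its
   partial inverse, undefined on the two border indices. *)
Definition inner (i : 'I_n) : 'I_n.+2 := lift ord0 (lift ord_max i).

Definition inner_inv (i : 'I_n.+2) : option 'I_n :=
  obind (unlift ord_max) (unlift ord0 i).

Definition even_reduce : 'rV[int]_n :=
  \row_i (R 0 (inner i) - even_v (inner i)
          - (1 - even_v (rev_ord (inner i)))).

Definition even_extend (T' : 'M[int]_n) : 'M[int]_n.+2 :=
  \matrix_(i, j)
    match inner_inv i, inner_inv j with
    | Some i', Some j' => T' i' j'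
    | _, _ =>
      if i == j then 0
      else if i == ord0 then even_v (rev_ord j)
      else if j == ord0 then 1 - even_v (rev_ord i)
      else if j == ord_max then even_v i
      else 1 - even_v j
    end.

End EvenStep.

Section OddStep.
(* Used with [n] even; the input then has odd length [n.+1] and middle index
   [n./2]. *)
Variable n : nat.

Definition odd_reduce (R : 'rV[int]_n.+1) : 'rV[int]_n :=
  \row_i (if (i < n./2)%N then R 0 (widen_ord (leqnSn n) i)
          else R 0 (lift ord0 i) - 1).

Definition odd_extend (T' : 'M[int]_n) : 'M[int]_n.+1 :=
  let mid : 'I_n.+1 := inord n./2 in
  \matrix_(i, j)
    match unlift mid i, unlift mid j with
    | Some i', Some j' => T' i' j'
    | None, _ => (j < n./2)%N%:R
    | Some _, None => (n./2 < i)%N%:R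
    end.

End OddStep.

(* The algorithm leaves the choice of the sorting permutation open, so it is a
   relation: [hankel_output R T] says that some execution on [R] returns [T]. *)
Inductive hankel_output : forall n : nat, 'rV[int]_n -> 'M[int]_n -> Prop :=
| Output0 (R : 'rV[int]_0) (T : 'M[int]_0) : hankel_output R T
| OutputEven (n : nat) (R : 'rV[int]_n.+2) (q : 'S_n) (T : 'M[int]_n) :
    ~~ odd n ->
    sorting_perm (even_reduce R) q ->
    hankel_output (even_reduce R *m (perm_mx q)^T) T ->
    hankel_output R (even_extend R ((perm_mx q)^T *m T *m perm_mx q))
| OutputOdd (n : nat) (R : 'rV[int]_n.+1) (q : 'S_n) (T : 'M[int]_n) :
    ~~ odd n ->
    sorting_perm (odd_reduce R) q ->
    hankel_output (odd_reduce R *m (perm_mx q)^T) T ->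
    hankel_output R (odd_extend ((perm_mx q)^T *m T *m perm_mx q)).

(* No execution on [R] gets stuck, whatever permutations are chosen: every
   (recursive) call receives a legal input and finds a sorting permutation. *)
Inductive hankel_succeeds : forall n : nat, 'rV[int]_n -> Prop :=
| Succeeds0 (R : 'rV[int]_0) : hankel_input R -> hankel_succeeds R
| SucceedsEven (n : nat) (R : 'rV[int]_n.+2) :
    ~~ odd n ->
    hankel_input R ->
    (exists q : 'S_n, sorting_perm (even_reduce R) q) ->
    (forall q : 'S_n, sorting_perm (even_reduce R) q ->
       hankel_succeeds (even_reduce R *m (perm_mx q)^T)) ->
    hankel_succeeds R
| SucceedsOdd (n : nat) (R : 'rV[int]_n.+1) :
    ~~ odd n ->
    hankel_input R ->
    (exists q : 'S_n, sorting_perm (odd_reduce R) q) ->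
    (forall q : 'S_n, sorting_perm (odd_reduce R) q ->
       hankel_succeeds (odd_reduce R *m (perm_mx q)^T)) ->
    hankel_succeeds R.

(* Main.v *)
Require Import Defs.
From HB Require Import structures.
From mathcomp Require Import all_boot all_order all_algebra all_fingroup.
From mathcomp Require Import zify ring.

Set Implicit Arguments.
Unset Strict Implicit.
Unset Printing Implicit Defensive.

Import Order.TTheory GRing.Theory Num.Theory.
Local Open Scope ring_scope.

(** Each step of the algorithm deletes the first and last player (even order) or
    the middle player (odd order), and fixes the results of their games. Adding
    these games back to a Hankel tournament with the reduced scores gives a
    Hankel tournament with the original scores ([even_extend_class],
    [odd_extend_class]): this is a check of entries and row sums. What needs an
    argument is that the reduced vector can be sorted by interchanges, and that
    it is again a legal input.

    Sorting is [sorting_perm_exists]: a composition of interchanges that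
    maximises [\sum_x x * R (q x)] sorts [R]. All such permutations commute with
    the reversal of indices, so undoing them preserves Hankel tournaments
    ([unsorted_hankel_class]).

    For legality, Landau's inequalities are extended from prefixes to all sets
    of players, which makes them independent of the order of the scores. A set
    [S] for which the inequality is tightest is a critical set: it consists of
    the players with score below [#|S|], and by complementarity it can be
    assumed to contain at most half of the players ([landau_critical]). For such
    sets the reduced scores can be compared directly with the original ones
    ([even_reduce_landau], [odd_reduce_landau]). In the even case, with first
    score [r1], this uses the precise choice of opponents: the first player wins
    against the next [r1] players in the order, the weakest ones. *)

(** * Landau's condition over arbitrary sets of players *)

Definition complementary_scores n (r : 'I_n -> int) :=
  forall i, r i + r (rev_ord i) = n%:Z - 1.

(** Landau's inequality for the set [S] of players, doubled so that the binomial
    coefficient becomes the polynomial [k * (k - 1)]. *)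
Definition excess n (r : 'I_n -> int) (S : {set 'I_n}) : int :=
  2 * \sum_(i in S) r i - #|S|%:Z * (#|S|%:Z - 1).

(** Quantifying over all sets, and not over prefixes only, makes the condition
    invariant under permutation of the scores: it can be checked before a
    reduced score vector is sorted. *)
Definition landau_condition n (r : 'I_n -> int) := forall S, 0 <= excess r S.

Lemma double_bin2 k : 2 * 'C(k, 2)%:Z = k%:Z * (k%:Z - 1).
Proof.
elim: k => [|k IHk] //.
rewrite binS bin1 PoszD mulrDr IHk -[k.+1]addn1; lia.
Qed.

Lemma card_prefix n k : (k <= n)%N -> #|[set i : 'I_n | (i < k)%N]| = k.
Proof.
move=> lekn; rewrite -[RHS]card_ord.
rewrite -(card_imset predT (f := widen_ord lekn)); last first.
  by move=> i j [] /val_inj.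
apply: eq_card => i; rewrite !inE; apply/idP/imsetP => [ltik | [j _ ->]].
  by exists (Ordinal ltik) => //; apply: val_inj.
by rewrite /=.
Qed.

Lemma sum_prefix n k : (k <= n)%N -> \sum_(i < n) ((i < k)%N%:R : int) = k%:Z.
Proof.
move=> lekn; rewrite (eq_bigr (fun i : 'I_n => if (i < k)%N then 1 else 0)).
  rewrite -big_mkcond /= sumr_const natz -[in RHS](card_prefix lekn).
  by congr Posz; apply: eq_card => i; rewrite in_set.
by move=> i _; case: ltnP.
Qed.

Lemma card_mul_le_sum (I : finType) (A : {set I}) (f : I -> int) (c : int) :
  (forall i, i \in A -> c <= f i) -> #|A|%:Z * c <= \sum_(i in A) f i.
Proof.
move=> fc; rewrite mulrC -[X in _ * X]natz mulr_natr -sumr_const.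
exact: ler_sum.
Qed.

Lemma sum_complementary n (r : 'I_n -> int) : complementary_scores r ->
  2 * \sum_i r i = n%:Z * (n%:Z - 1).
Proof.
move=> rC.
have -> : 2 * \sum_i r i = \sum_i (r i + r (rev_ord i)).
  rewrite big_split /= [X in _ = _ + X](reindex_inj rev_ord_inj) /=.
  under [X in _ = _ + X]eq_bigr => i _ do rewrite rev_ordK.
  by ring.
under eq_bigr => i _ do rewrite rC.
by rewrite sumr_const card_ord -mulr_natl natz.
Qed.

(** The players outside [S] have total score
    [n (n - 1) / 2 - \sum_(i in S) r i], and passing to the complementary
    indices replaces each score [x] by [n - 1 - x]. *)
Lemma excess_rev_compl n (r : 'I_n -> int) (S : {set 'I_n}) :
  complementary_scores r -> excess r [set rev_ord i | i in ~: S] = excess r S.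
Proof.
move=> rC; rewrite /excess big_imset /=; last by move=> i j _ _ /rev_ord_inj.
rewrite card_imset; last exact: rev_ord_inj.
have -> : \sum_(i in ~: S) r (rev_ord i)
          = #|~: S|%:Z * (n%:Z - 1) - \sum_(i in ~: S) r i.
  have e i : r (rev_ord i) = (n%:Z - 1) - r i by rewrite -(rC i); ring.
  under eq_bigr => i _ do rewrite e.
  by rewrite sumrB sumr_const -[_ *+ _]mulr_natl natz.
have := sum_complementary rC; rewrite (bigID (mem S)) /=.
under [X in _ + X]eq_bigl => i do rewrite -in_setC.
have -> : #|~: S|%:Z = n%:Z - #|S|%:Z.
  apply/eqP; rewrite eq_sym subr_eq -PoszD addnC; apply/eqP; congr Posz.
  by rewrite cardsC card_ord.
set a := \sum_(i in S) _; set b := \sum_(i in _) _.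
move: a b (Posz #|S|) => a b k e.
have -> : 2 * ((n%:Z - k) * (n%:Z - 1) - b)
          = 2 * (n%:Z - k) * (n%:Z - 1) + 2 * a - 2 * (a + b) by ring.
rewrite e; ring.
Qed.

Lemma excess_setU1 n (r : 'I_n -> int) (S : {set 'I_n}) i : i \notin S ->
  excess r (i |: S) = excess r S + 2 * (r i - #|S|%:Z).
Proof. by move=> iNS; rewrite /excess big_setU1 //= cardsU1 iNS intS; ring. Qed.

(** Take a set [S] of minimal excess. Neither removing nor adding a player
    lowers the excess, so [S] consists exactly of the players with score below
    [#|S|]; by [excess_rev_compl] it may be replaced by the reversal of its
    complement, so it has at most half of the players. Only such critical sets
    have to be examined. *)
Lemma landau_critical n (r : 'I_n -> int) : complementary_scores r ->
  (forall S : {set 'I_n}, (#|S|.*2 <= n)%N ->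
     (forall i, i \in S -> r i < #|S|%:Z) ->
     (forall i, i \notin S -> #|S|%:Z <= r i) -> 0 <= excess r S) ->
  landau_condition r.
Proof.
move=> rC crit S.
suff [S0 S0half S0min] : exists2 S0 : {set 'I_n}, (#|S0|.*2 <= n)%N &
    forall S', excess r S0 <= excess r S'.
  apply: le_trans (S0min S); apply: crit => // i iS0; last first.
    have := S0min (i |: S0); rewrite excess_setU1 //; lia.
  have := S0min (S0 :\ i); rewrite -{1}(setD1K iS0) excess_setU1 ?setD11 //.
  rewrite (cardsD1 i S0) iS0; lia.
case: (arg_minP (excess r) (isT : xpredT (set0 : {set 'I_n}))) => S0 _ S0min.
have {}S0min S' : excess r S0 <= excess r S' by exact: S0min.
have [half | half] := leqP #|S0|.*2 n; first by exists S0.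
exists [set rev_ord i | i in ~: S0]; last by move=> S'; rewrite excess_rev_compl.
rewrite card_imset; last exact: rev_ord_inj.
have -> : #|~: S0| = (n - #|S0|)%N by rewrite cardsCs setCK card_ord.
move: half; move: #|S0| => k; lia.
Qed.

(** With [c] the score at position [#|S|], the players before that position
    score at most [c] and the others at least [c]; hence exchanging the members
    of [S] for the members of the prefix cannot increase the sum. *)
Lemma landau_of_prefix n (r : 'I_n -> int) :
  (forall i j : 'I_n, (i <= j)%N -> r i <= r j) ->
  (forall k, (k <= n)%N -> 0 <= excess r [set i : 'I_n | (i < k)%N]) ->
  landau_condition r.
Proof.
move=> rS pre S; have leSn : (#|S| <= n)%N by rewrite -[n in leqRHS]card_ord max_card.
apply: le_trans (pre _ leSn) _; rewrite /excess card_prefix // lerD2r ler_pM2l //.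
set P := [set i : 'I_n | _].
have cardP : #|P| = #|S| by rewrite card_prefix.
have [c cP cNP] : exists2 c, (forall i, i \in P -> r i <= c) &
                             (forall i, i \notin P -> c <= r i).
  case: (ltnP #|S| n) => [ltSn | geSn].
    exists (r (Ordinal ltSn)) => i; rewrite inE => h; apply: rS.
      exact: ltnW.
    by rewrite /= leqNgt.
  (* Here the prefix is everything, and any upper bound of the scores will do. *)
  exists (\sum_i `|r i|) => i; rewrite inE => h; last by case/negP: h; exact: leq_trans geSn.
  rewrite (bigD1 i) //=; apply: le_trans (ler_norm _) _.
  by rewrite lerDl sumr_ge0.
have shift (U : {set 'I_n}) : #|U| = #|S| ->
    \sum_(i in U) r i = \sum_(i in U) (r i - c) + c *+ #|S|.
  by move=> <-; rewrite sumrB sumr_const; ring.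
rewrite (shift P) // (shift S) // lerD2r.
rewrite (bigID (mem S)) /= [leRHS](bigID (mem P)) /=.
rewrite (eq_bigl (fun i => (i \in S) && (i \in P))); last by move=> i; rewrite andbC.
rewrite lerD2l; apply: (@le_trans _ _ 0).
  by apply: sumr_le0 => i /andP[/cP]; lia.
by apply: sumr_ge0 => i /andP[_ /cNP]; lia.
Qed.

Lemma excess_prefix n (r : 'I_n -> int) k : (k <= n)%N ->
  (0 <= excess r [set i : 'I_n | (i < k)%N])
  = ('C(k, 2)%:Z <= \sum_(i < n | (i < k)%N) r i).
Proof.
move=> lekn; rewrite /excess card_prefix // -double_bin2 -mulrBr pmulr_rge0 //.
by rewrite subr_ge0; congr (_ <= _); apply: eq_bigl => i; rewrite inE.
Qed.

Lemma hankel_input_landau n (R : 'rV[int]_n) : hankel_input R ->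
  complementary_scores (R 0) /\ landau_condition (R 0).
Proof.
case=> _ RS RC RL _; split=> //; apply: landau_of_prefix => // k lekn.
rewrite excess_prefix //; case: k lekn => [_ | k lekn]; last exact: RL.
by rewrite big_pred0.
Qed.

Lemma landau_hankel_input n (R : 'rV[int]_n) :
  nondecreasing_vec R -> complementary_scores (R 0) -> landau_condition (R 0) ->
  hankel_input R.
Proof.
move=> RS RC RL; split=> // [i | k /andP[_ lekn] |].
- by have := RL [set i]; rewrite /excess big_set1 cards1; lia.
- by rewrite -excess_prefix.
- by apply/(@mulfI _ 2); rewrite // sum_complementary // double_bin2.
Qed.

(** * Sorting by interchanges *)

Lemma row_perm_trE n (R : 'rV[int]_n) (q : 'S_n) i :
  (R *m (perm_mx q)^T) 0 i = R 0 (q i).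
Proof. by rewrite tr_perm_mx -col_permE mxE. Qed.

Lemma conj_permE n (T : 'M[int]_n) (q : 'S_n) i j :
  ((perm_mx q)^T *m T *m perm_mx q) i j = T ((q^-1)%g i) ((q^-1)%g j).
Proof. by rewrite tr_perm_mx -row_permE -[X in _ *m perm_mx X]invgK -col_permE !mxE. Qed.

Lemma rev_ord_neq n (i : 'I_n) : ~~ odd n -> rev_ord i != i.
Proof. by move=> nE; rewrite -(inj_eq val_inj) /=; have := ltn_ord i; lia. Qed.

Lemma tperm_rev n (i j x : 'I_n) :
  tperm (rev_ord i) (rev_ord j) (rev_ord x) = rev_ord (tperm i j x).
Proof.
case: tpermP => [/rev_ord_inj->|/rev_ord_inj->|].
- by rewrite tpermL.
- by rewrite tpermR.
by move=> xi xj; rewrite tpermD //; apply/eqP => e; [apply: xi | apply: xj]; rewrite e.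
Qed.

(** For even order no index is its own complement, so the two transpositions of
    a double interchange commute and their product commutes with reversal. *)
Lemma interchanges_rev n (q : 'S_n) : ~~ odd n ->
  q \in <<hankel_interchanges n>>%g -> forall i, q (rev_ord i) = rev_ord (q i).
Proof.
move=> nE; pose revP : 'S_n := perm (@rev_ord_inj n).
have revPE x : revP x = rev_ord x by rewrite permE.
suff sub : hankel_interchanges n \subset 'C[revP]%g.
  rewrite -(gen_subG _ 'C[revP]%G) in sub.
  move=> /(subsetP sub) /cent1P qrev i.
  by have := congr1 (fun p : 'S_n => p i) qrev; rewrite /= !permM !revPE => ->.
apply/subsetP => g /setUP[] /imsetP[].
  move=> i _ ->; apply/cent1P/permP => x; rewrite !permM !revPE.
  by rewrite -tperm_rev rev_ordK tpermC.
case=> i j _ -> /=; apply/cent1P/permP => x; rewrite !permM !revPE.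
(* Conjugation by the reversal swaps the two transpositions. *)
rewrite -!tperm_rev !rev_ordK.
have tC : commute (tperm i j) (tperm (rev_ord i) (rev_ord j)).
  have iN := rev_ord_neq i nE; have jN := rev_ord_neq j nE.
  have [-> | ji] := eqVneq j (rev_ord i); first by rewrite rev_ordK (tpermC (rev_ord i)).
  have ij : rev_ord j != i by apply: contra ji => /eqP<-; rewrite rev_ordK.
  apply/commgP/conjg_fixP; rewrite tpermJ !tpermD // eq_sym // rev_ord_neq.
by have := congr1 (fun p : 'S_n => p (rev_ord x)) tC; rewrite /= !permM.
Qed.

Lemma sum_tperm n (f : 'I_n -> int) (i j : 'I_n) : i != j ->
  \sum_(x < n) x%:Z * f (tperm i j x)
  = \sum_(x < n) x%:Z * f x + (j%:Z - i%:Z) * (f i - f j).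
Proof.
move=> ij; rewrite (bigD1 i) //= (bigD1 j) 1?eq_sym //= tpermL tpermR.
rewrite [in RHS](bigD1 i) //= [in RHS](bigD1 j) 1?eq_sym //=.
rewrite (eq_bigr (fun x : 'I_n => x%:Z * f x)); first by ring.
by move=> x /andP[xi xj]; rewrite tpermD // eq_sym.
Qed.

(** Among the compositions [q] of interchanges, one that maximises
    [\sum_x x * R (q x)] sorts [R]. Indeed, if [i < j] were out of order, then so
    would be the pair [rev_ord j < rev_ord i], because the scores are complementary;
    interchanging both pairs at once (or the single pair, if [j] is the
    complement of [i]) would increase the sum. *)
Lemma sorting_perm_exists n (R : 'rV[int]_n) : ~~ odd n ->
  complementary_scores (R 0) -> exists q : 'S_n, sorting_perm R q.
Proof.
move=> nE RC; pose Gr := (<<hankel_interchanges n>>)%g.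
pose weight (q : 'S_n) : int := \sum_(x < n) x%:Z * R 0 (q x).
have G1 : 1%g \in Gr by exact: group1.
case: (arg_maxP (P := fun q => q \in Gr) weight G1) => q /= qG qmax.
have qrev := interchanges_rev nE qG.
exists q; split=> // i j; rewrite leq_eqVlt => /orP[/eqP/val_inj-> // | ltij].
rewrite !row_perm_trE leNgt; apply/negP => ltR.
have ij : i != j by rewrite neq_ltn ltij.
have step (t : 'S_n) : t \in hankel_interchanges n -> weight (t * q)%g <= weight q.
  by move=> tI; apply: qmax; rewrite /= groupM // mem_gen.
have [ji | ji] := eqVneq j (rev_ord i).
  have tI : tperm i j \in hankel_interchanges n.
    by rewrite ji inE (imset_f (fun i => tperm i (rev_ord i))).
  have := step _ tI; rewrite /weight.
  under eq_bigr => x _ do rewrite permM.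
  rewrite (sum_tperm (fun x => R 0 (q x))) //.
  have : 0 < (j%:Z - i%:Z) * (R 0 (q i) - R 0 (q j)).
    by apply: mulr_gt0; lia.
  lia.
have rij : rev_ord i != rev_ord j by rewrite (inj_eq rev_ord_inj).
have := step (tperm i j * tperm (rev_ord i) (rev_ord j))%g.
have -> : (tperm i j * tperm (rev_ord i) (rev_ord j) \in hankel_interchanges n)%g.
  by rewrite inE orbC (imset_f (fun ij : 'I_n * 'I_n =>
       tperm ij.1 ij.2 * tperm (rev_ord ij.1) (rev_ord ij.2))%g (x := (i, j))).
move=> /(_ isT); rewrite /weight.
under eq_bigr => x _ do rewrite !permM.
rewrite (sum_tperm (fun x => R 0 (q (tperm (rev_ord i) (rev_ord j) x)))) //.
rewrite (sum_tperm (fun x => R 0 (q x))) //.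
have ir : rev_ord j != i by apply: contra ji => /eqP<-; rewrite rev_ordK.
rewrite !(tpermD, rev_ord_neq) // 1?eq_sym // !qrev.
(* By complementarity both transpositions contribute the same positive amount. *)
have e k : R 0 (rev_ord (q k)) = n%:Z - 1 - R 0 (q k) by rewrite -(RC (q k)); ring.
rewrite !e /=.
have : 0 < (j%:Z - i%:Z) * (R 0 (q i) - R 0 (q j)) by apply: mulr_gt0; lia.
have -> : (n - j.+1)%:Z - (n - i.+1)%:Z = i%:Z - j%:Z.
  by have := ltn_ord i; have := ltn_ord j; lia.
set d := R 0 (q i) - _.
have -> : n%:Z - 1 - R 0 (q i) - (n%:Z - 1 - R 0 (q j)) = - d by rewrite /d; ring.
rewrite mulrN -mulNr opprB; lia.
Qed.

Lemma sorted_hankel_input n (R : 'rV[int]_n) (q : 'S_n) : ~~ odd n ->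
  complementary_scores (R 0) -> landau_condition (R 0) -> sorting_perm R q ->
  hankel_input (R *m (perm_mx q)^T).
Proof.
move=> nE RC RL [qI qS]; have qrev := interchanges_rev nE qI.
apply: landau_hankel_input => // [i | S]; first by rewrite !row_perm_trE qrev RC.
have := RL [set q i | i in S]; rewrite /excess big_imset /=; last first.
  by move=> i j _ _ /perm_inj.
rewrite card_imset; last exact: perm_inj.
by under [X in _ -> 0 <= 2 * X - _]eq_bigr => i _ do rewrite row_perm_trE.
Qed.

(** Relabelling the players by a permutation that commutes with reversal
    preserves the Hankel symmetry and permutes the scores. *)
Lemma unsorted_hankel_class n (R : 'rV[int]_n) (q : 'S_n) (T : 'M[int]_n) :
  ~~ odd n -> q \in <<hankel_interchanges n>>%g ->
  hankel_class (R *m (perm_mx q)^T) T ->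
  hankel_class R ((perm_mx q)^T *m T *m perm_mx q).
Proof.
move=> nE qI [[[T01 T0 TC] TH] TS].
have qrev := interchanges_rev nE (groupVr qI).
split; [split; first split|].
- by move=> i j; rewrite conj_permE.
- by move=> i; rewrite conj_permE.
- by move=> i j ij; rewrite !conj_permE TC // (inj_eq perm_inj).
- by apply/matrixP => i j; rewrite mxE !conj_permE !qrev -[in RHS]TH mxE.
- apply/rowP => i; rewrite mxE.
  under eq_bigr => j _ do rewrite conj_permE.
  rewrite -(reindex_inj (P := xpredT) (F := fun j => T ((q^-1)%g i) j) (@perm_inj _ (q^-1)%g)) /=.
  by have /rowP/(_ ((q^-1)%g i)) := TS; rewrite mxE row_perm_trE permKV.
Qed.

(** * The even step *)

(** The last estimate of [even_reduce_landau]: [t] of the [k] scores are at least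
    [k1 - 1] and the others at least [k - 1]. If [k < 2 * k1], both bounds are at
    least the required mean [(k - 1) / 2]; otherwise [t <= k / 2], and the large
    scores suffice. *)
Lemma mixed_bounds_landau (s : int) (k k1 t : nat) : (t < k1)%N -> (t <= k)%N ->
  t%:Z * (k1%:Z - 1) + (k%:Z - t%:Z) * (k%:Z - 1) <= s ->
  0 <= 2 * s - k%:Z * (k%:Z - 1).
Proof.
move=> ltt let_ les; have [k0 | k_gt0] := posnP k.
  by move: les; rewrite k0; have -> : t = 0%N by [lia]; lia.
have kt : 0 <= (k%:Z - t%:Z) * (k%:Z - 1) by apply: mulr_ge0; lia.
have t1 : 0 <= t%:Z * (k1%:Z - 1) by apply: mulr_ge0; lia.
have [lek | ltk] := leqP k.+1 k1.*2.
  have : 0 <= t%:Z * (k1%:Z *+ 2 - 1 - k%:Z) by apply: mulr_ge0; lia.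
  lia.
have : 0 <= (k%:Z - t%:Z *+ 2) * (k%:Z - 1) by apply: mulr_ge0; lia.
lia.
Qed.

Section EvenStep.
Variable n : nat.

Lemma val_inner (i : 'I_n) : inner i = i.+1 :> nat.
Proof. by rewrite /inner /= /bump (leqNgt n) ltn_ord. Qed.

Lemma rev_inner (i : 'I_n) : rev_ord (inner i) = inner (rev_ord i).
Proof.
apply: ord_inj; rewrite val_inner; have := ltn_ord i.
rewrite /= /bump; lia.
Qed.

Lemma rev_ord_max m : rev_ord (ord_max : 'I_m.+1) = ord0.
Proof. by apply: val_inj; rewrite /= subnn. Qed.

Lemma rev_ord0 m : rev_ord (ord0 : 'I_m.+1) = ord_max.
Proof. by apply: val_inj; rewrite /= subn1. Qed.

Lemma inner_neq0 (i : 'I_n) : (inner i == ord0) = false.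
Proof. by rewrite -(inj_eq (@ord_inj _)) val_inner. Qed.

Lemma inner_neq_max (i : 'I_n) : (inner i == ord_max) = false.
Proof.
rewrite -(inj_eq (@ord_inj _)) val_inner /=; have := ltn_ord i; lia.
Qed.

Lemma inner_invK (i : 'I_n) : inner_inv (inner i) = Some i.
Proof. by rewrite /inner_inv /inner liftK /= liftK. Qed.

Lemma inner_inv_ord0 : inner_inv (ord0 : 'I_n.+2) = None.
Proof. by rewrite /inner_inv unlift_none. Qed.

Lemma inner_inv_ord_max : inner_inv (ord_max : 'I_n.+2) = None.
Proof.
have -> : (ord_max : 'I_n.+2) = lift ord0 ord_max by exact: val_inj.
by rewrite /inner_inv liftK /= unlift_none.
Qed.

Variant inner_spec : 'I_n.+2 -> Type :=
| IsFirst : inner_spec ord0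
| IsLast : inner_spec ord_max
| IsInner i : inner_spec (inner i).

Lemma innerP i : inner_spec i.
Proof.
case: (unliftP ord0 i) => [j|] ->; last exact: IsFirst.
case: (unliftP ord_max j) => [k|] ->; first exact: IsInner.
have -> : lift ord0 ord_max = (ord_max : 'I_n.+2) by exact: val_inj.
exact: IsLast.
Qed.

Lemma big_ord_inner (F : 'I_n.+2 -> int) :
  \sum_i F i = F ord0 + F ord_max + \sum_i F (inner i).
Proof.
rewrite big_ord_recl big_ord_recr /= -addrA [X in _ + X]addrC; congr (_ + (F _ + _)).
  exact: val_inj.
by apply: eq_bigr => i _; congr (F _); apply: ord_inj; rewrite val_inner.
Qed.

Variable R : 'rV[int]_n.+2.

Let r1 := R 0 ord0.

Lemma even_v_inner i : even_v R (inner i) = (n%:Z - r1 <= i%:Z)%R%:R.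
Proof.
rewrite /even_v val_inner -/r1 ltnS ltn_ord andbT; congr ((nat_of_bool _)%:R).
by lia.
Qed.

Lemma even_v_rev_inner i : even_v R (rev_ord (inner i)) = (i%:Z < r1)%R%:R.
Proof.
rewrite rev_inner even_v_inner /=; congr ((nat_of_bool _)%:R).
by have := ltn_ord i; lia.
Qed.

Lemma even_v_01 i : even_v R i \in [:: 0; 1].
Proof. by rewrite /even_v; case: (_ && _). Qed.

(** For a legal input the first [r1] inner players lose to both border players,
    their complements beat both, and everyone else beats exactly one of them. *)
Lemma even_reduceE i :
  even_reduce R 0 i = R 0 (inner i) - 1 + (i%:Z < r1)%R%:R
                      - (n%:Z - r1 <= i%:Z)%R%:R.
Proof. by rewrite mxE even_v_rev_inner even_v_inner; ring. Qed.

Hypothesis RI : hankel_input R.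

Lemma even_reduce_complementary : complementary_scores (even_reduce R 0).
Proof.
have [_ _ RC _ _] := RI.
move=> i; rewrite !even_reduceE -rev_inner.
have -> : R 0 (rev_ord (inner i)) = n.+2%:Z - 1 - R 0 (inner i).
  by rewrite -(RC (inner i)); ring.
have -> : ((rev_ord i)%:Z < r1)%R = (n%:Z - r1 <= i%:Z).
  by have := ltn_ord i; rewrite /=; lia.
have -> : (n%:Z - r1 <= (rev_ord i)%:Z)%R = (i%:Z < r1).
  by have := ltn_ord i; rewrite /=; lia.
by lia.
Qed.

Hypothesis nE : ~~ odd n.

(** [r1] and the last score add up to the odd number [n + 1], and [r1] is the
    smaller one. So the low inner players, those of index below [r1], and the
    high ones, their complements, are disjoint. *)
Lemma first_score : exists2 k : nat, r1 = k%:Z & (k.*2 <= n)%N.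
Proof.
case: RI => /(_ ord0) r0 /(_ ord0 ord_max isT) le /(_ ord0); rewrite rev_ord0 -/r1.
move: r0 le; rewrite -/r1; case: r1 => // k _ le e; exists k => //.
by move: nE le e; move: (R 0 ord_max) => x; lia.
Qed.

Lemma even_v_ord0 : even_v R ord0 = 0.
Proof.
have [k e le] := first_score; rewrite /even_v -/r1 e.
by rewrite (_ : _ <= _ = false) //=; apply/negP; lia.
Qed.

(** Let [S] be a critical set of [k <= n / 2] inner players. If [S] contains all
    the low players [i < r1], it contains no high one, its members lose
    [k - r1] points in all, and Landau's inequality for [S] together with the
    first player gives the claim. Otherwise some low player [i0] is not in [S]:
    its score is untouched and at least [k], so every later player keeps a score
    of at least [k - 1]. Fewer than [r1] players come before [i0], and no
    reduced score is below [r1 - 1]. *)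
Lemma even_reduce_landau : landau_condition (even_reduce R 0).
Proof.
have [_ RS RC _ _] := RI; have [_ RL] := hankel_input_landau RI.
have R'C := even_reduce_complementary.
have [k1 r1E lek1] := first_score.
apply: landau_critical => // S lek inS notinS.
set k := #|S| in lek inS notinS *.
(* The upper half of the players have scores of at least [n / 2 + 1]. *)
have upper (i : 'I_n) : (n <= i.*2)%N -> n.+2%:Z <= 2 * R 0 (inner i).
  move=> le; have := RC (inner i).
  have : R 0 (rev_ord (inner i)) <= R 0 (inner i).
    by apply: RS; rewrite rev_inner !val_inner /=; have := ltn_ord i; lia.
  by move: nE; move: (R 0 (inner i)) (R 0 (rev_ord _)) => a b; lia.
have [/forallP AS | /forallPn[i0]] := boolP [forall i : 'I_n, (i < k1)%N ==> (i \in S)].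
  have S'E : \sum_(i in S) even_reduce R 0 i = \sum_(i in S) R 0 (inner i) - k%:Z + k1%:Z.
    have e i : i \in S -> even_reduce R 0 i = R 0 (inner i) - 1 + (i < k1)%N%:R.
      move=> iS; rewrite even_reduceE r1E ltz_nat.
      case: leP => [le | _]; last by rewrite subr0.
      (* Complementary scores cannot both be below [k <= n / 2]. *)
      have : rev_ord i \in S by apply: (implyP (AS _)); rewrite /=; have := ltn_ord i; lia.
      by move=> /inS; have := inS _ iS; have := R'C i; lia.
    rewrite (eq_bigr _ e) !big_split /= sumr_const.
    rewrite -[X in _ = _ + X](@sum_prefix n); last by lia.
    rewrite [\sum_(i < n) _](bigID (mem S)) /= [X in _ + (_ + X)]big1.
      by rewrite addr0 mulNrn natz.
    by move=> i iS; case: ltnP => // lt; have := AS i; rewrite lt (negPf iS).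
  have inner_inj : injective (@inner n).
    by move=> i j e; apply: Some_inj; rewrite -!inner_invK e.
  have N0 : ord0 \notin (@inner n) @: S.
    by apply/imsetP => -[i _ /(congr1 (@nat_of_ord _))]; rewrite val_inner.
  have := RL (ord0 |: @inner n @: S); rewrite excess_setU1 // /excess S'E.
  rewrite card_imset // big_imset /=; last by move=> i j _ _ /inner_inj.
  by rewrite -/k -/r1 r1E; move: (\sum_(i in S) _) => a; lia.
rewrite negb_imply => /andP[lti0 i0S].
have Ri0 : k%:Z <= R 0 (inner i0).
  have := notinS _ i0S; rewrite even_reduceE r1E ltz_nat lti0.
  by case: leP => le; lia.
have low i : k1%:Z - 1 <= even_reduce R 0 i.
  have R1 : r1 <= R 0 (inner i) by apply: RS.
  rewrite even_reduceE; have := @upper i; move: R1; rewrite r1E ltz_nat.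
  by case: ltnP; case: leP; lia.
have high (i : 'I_n) : (i0 <= i)%N -> k%:Z - 1 <= even_reduce R 0 i.
  move=> le0; have Ri : R 0 (inner i0) <= R 0 (inner i) by apply: RS; rewrite !val_inner.
  rewrite even_reduceE; have := @upper i; rewrite r1E ltz_nat.
  by case: ltnP; case: leP; lia.
set U := [set i in S | (i < i0)%N].
have US : U \subset S by apply/subsetP => i; rewrite inE => /andP[].
have cU : (#|U| < k1)%N.
  apply: leq_ltn_trans lti0; rewrite -(card_prefix (ltnW (ltn_ord i0))).
  by apply: subset_leq_card; apply/subsetP => i; rewrite !inE => /andP[].
have lekU : (#|U| <= k)%N by exact: subset_leq_card.
have : #|U|%:Z * (k1%:Z - 1) + (k%:Z - #|U|%:Z) * (k%:Z - 1)
       <= \sum_(i in S) even_reduce R 0 i.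
  rewrite (big_setID U) /= (setIidPr US); apply: lerD.
    by apply: card_mul_le_sum => i _; apply: low.
  have -> : k%:Z - #|U|%:Z = #|S :\: U|%:Z.
    by rewrite cardsD (setIidPr US) subzn.
  apply: card_mul_le_sum => i; rewrite !inE => /andP[+ iS]; rewrite iS /= -leqNgt.
  exact: high.
rewrite /excess -/k; move: (\sum_(i in S) _) => s.
exact: mixed_bounds_landau.
Qed.

(** Each border line is given by one formula, because at the two corners off the
    diagonal the formulas of the row and of the column agree. *)
Lemma even_extendE (T : 'M[int]_n) :
  [/\ forall i j, even_extend R T (inner i) (inner j) = T i j,
      forall j, even_extend R T ord0 j = if j == ord0 then 0 else even_v R (rev_ord j),
      forall i, even_extend R T i ord0 = if i == ord0 then 0 else 1 - even_v R (rev_ord i),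
      forall i, even_extend R T i ord_max = if i == ord_max then 0 else even_v R i
    & forall j, even_extend R T ord_max j = if j == ord_max then 0 else 1 - even_v R j].
Proof.
split=> [i j | j | i | i | j]; rewrite mxE.
- by rewrite !inner_invK.
- by rewrite inner_inv_ord0 eq_sym.
- rewrite inner_inv_ord0; case: (inner_inv i) => [_|]; case: eqP => // _.
- rewrite inner_inv_ord_max; case: (innerP i) => [||k].
  + by rewrite inner_inv_ord0 /= rev_ord_max.
  + by rewrite inner_inv_ord_max eqxx.
  + by rewrite inner_invK /= eqxx.
- rewrite inner_inv_ord_max [ord_max == j]eq_sym; case: (innerP j) => [||k] //.
  + by rewrite /= rev_ord_max.
  + by rewrite !eqxx.
  + by rewrite inner_neq_max inner_neq0.
Qed.

Lemma even_extend_class (T : 'M[int]_n) :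
  hankel_class (even_reduce R) T -> hankel_class R (even_extend R T).
Proof.
have [_ _ RC _ _] := RI.
case=> -[[T01 T0 TC] TH] TS.
have [Eii E0 Ej0 Em Ejm] := even_extendE T.
have v01 := even_v_01; have [k1 r1E lek1] := first_score.
have N01 (x : int) : x \in [:: 0; 1] -> 1 - x \in [:: 0; 1].
  by rewrite !inE => /orP[] /eqP->.
split; [split; first split|].
- move=> i j; case: (innerP i) => [||i'].
  + by rewrite E0; case: ifP.
  + by rewrite Ejm; case: ifP => // _; apply: N01.
  case: (innerP j) => [||j'].
  + by rewrite Ej0 inner_neq0; apply: N01.
  + by rewrite Em inner_neq_max.
  + by rewrite Eii.
- move=> i; case: (innerP i) => [||i'].
  + by rewrite E0.
  + by rewrite Ejm eqxx.
  + by rewrite Eii.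
- move=> i j; case: (innerP i) => [||i'].
  + by rewrite eq_sym E0 Ej0 => /negPf->; ring.
  + by rewrite eq_sym Em Ejm => /negPf->.
  case: (innerP j) => [||j'].
  + by rewrite E0 Ej0 => /negPf->.
  + by rewrite Em Ejm => /negPf->; ring.
  + move=> ij; rewrite !Eii TC //; apply: contra ij => /eqP->; exact: eqxx.
- apply/matrixP => i j; rewrite mxE.
  have rev0 (x : 'I_n.+2) : (rev_ord x == ord_max) = (x == ord0).
    by rewrite -rev_ord0 (inj_eq rev_ord_inj).
  have revm (x : 'I_n.+2) : (rev_ord x == ord0) = (x == ord_max).
    by rewrite -rev_ord_max (inj_eq rev_ord_inj).
  case: (innerP i) => [||i'].
  + by rewrite rev_ord0 Em E0 rev0.
  + by rewrite rev_ord_max Ej0 Ejm revm rev_ordK.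
  case: (innerP j) => [||j'].
  + by rewrite rev_ord0 Ejm Ej0 rev0.
  + by rewrite rev_ord_max E0 Em revm rev_ordK.
  + by rewrite !rev_inner !Eii -[in RHS]TH mxE.
have S1 : \sum_i even_v R (rev_ord (inner i)) = k1%:Z.
  rewrite -[RHS](@sum_prefix n); last by lia.
  by apply: eq_bigr => i _; rewrite even_v_rev_inner r1E ltz_nat.
apply/rowP => i; rewrite mxE big_ord_inner; case: (innerP i) => [||i'].
- rewrite E0 eqxx E0 /= rev_ord_max even_v_ord0 addr0 add0r -/r1 r1E -S1.
  by apply: eq_bigr => i' _; rewrite E0 inner_neq0.
- rewrite !Ejm eqxx /= even_v_ord0.
  under eq_bigr => i' _ do rewrite Ejm inner_neq_max.
  rewrite sumrB sumr_const card_ord natz.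
  have -> : \sum_i even_v R (inner i) = k1%:Z.
    by rewrite -S1 (reindex_inj rev_ord_inj); apply: eq_bigr => i' _; rewrite rev_inner.
  have := RC ord0; rewrite rev_ord0 -/r1 r1E; lia.
- rewrite Ej0 Em inner_neq0 inner_neq_max.
  under eq_bigr => j' _ do rewrite Eii.
  have /rowP/(_ i') := TS; rewrite !mxE => ->; ring.
Qed.

End EvenStep.

(** * The odd step *)

(** [k - l] further scores of at least [k - 1] keep Landau's inequality, since
    passing from [l] to [k] raises the binomial coefficient by
    [l + (l + 1) + ... + (k - 1)], each term of which is at most [k - 1]. *)
Lemma add_large_scores_landau (a b : int) (k l : nat) : (l <= k)%N ->
  (k%:Z - l%:Z) * (k%:Z - 1) <= b -> 0 <= 2 * a - l%:Z * (l%:Z - 1) ->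
  0 <= 2 * (a + b) - k%:Z * (k%:Z - 1).
Proof.
move=> lelk; rewrite -(subnKC lelk) PoszD; case: (k - l)%N => [|d]; first by lia.
have : 0 <= d.+1%:Z * d%:Z by [].
rewrite intS; lia.
Qed.

Section OddStep.
Variables (n : nat) (R : 'rV[int]_n.+1).
Hypotheses (nE : ~~ odd n) (RI : hankel_input R).

Let mid : 'I_n.+1 := inord n./2.

Lemma val_mid : mid = n./2 :> nat.
Proof. by rewrite /mid inordK //; lia. Qed.

Lemma rev_mid : rev_ord mid = mid.
Proof. by apply: val_inj; rewrite /= val_mid; move: nE; lia. Qed.

Lemma rev_lift_mid (i : 'I_n) : rev_ord (lift mid i) = lift mid (rev_ord i).
Proof. by apply: val_inj; rewrite /= /bump val_mid; have := ltn_ord i; move: nE; lia. Qed.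

Lemma mid_score : R 0 mid = (n./2)%:Z.
Proof. by have [_ _ RC _ _] := RI; have := RC mid; rewrite rev_mid; move: nE; lia. Qed.

(** Skipping the middle player turns the two cases of the reduction into one
    formula: the upper players lose the point that they win against the middle
    one. *)
Lemma odd_reduceE i :
  odd_reduce R 0 i = R 0 (lift mid i) - (n./2 <= i)%N%:R.
Proof.
rewrite mxE; case: ltnP => le; rewrite ?subr0; do ?congr (_ - _); congr (R 0 _).
  by apply: val_inj; rewrite /= /bump val_mid leqNgt le.
by apply: val_inj; rewrite /= /bump val_mid le.
Qed.

Lemma odd_reduce_complementary : complementary_scores (odd_reduce R 0).
Proof.
have [_ _ RC _ _] := RI => i; rewrite !odd_reduceE -rev_lift_mid.
have := RC (lift mid i); have := ltn_ord i; rewrite /=; move: nE.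
by move: (R 0 _) (R 0 _) => a b; case: leqP; case: leqP; lia.
Qed.

(** The members of [S] in the lower half keep their scores, and Landau's
    inequality holds for them. Those in the upper half scored at least as much
    as the middle player, that is [n / 2], and keep [n / 2 - 1 >= #|S| - 1]. *)
Lemma odd_reduce_landau : landau_condition (odd_reduce R 0).
Proof.
have [_ RS _ _ _] := RI; have [_ RL] := hankel_input_landau RI.
apply: landau_critical odd_reduce_complementary _ => S lek _ _.
set U := [set i in S | (i < n./2)%N].
have US : U \subset S by apply/subsetP => i; rewrite inE => /andP[].
have sumU : \sum_(i in U) odd_reduce R 0 i = \sum_(i in lift mid @: U) R 0 i.
  rewrite big_imset /=; last by move=> i j _ _ /lift_inj.
  apply: eq_bigr => i; rewrite inE => /andP[_ lt].
  by rewrite odd_reduceE leqNgt lt subr0.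
have := RL (lift mid @: U); rewrite /excess card_imset -?sumU; last exact: lift_inj.
have lekU : (#|U| <= #|S|)%N by exact: subset_leq_card.
have : (#|S|%:Z - #|U|%:Z) * (#|S|%:Z - 1) <= \sum_(i in S :\: U) odd_reduce R 0 i.
  have -> : #|S|%:Z - #|U|%:Z = #|S :\: U|%:Z.
    by rewrite cardsD (setIidPr US) subzn.
  apply: card_mul_le_sum => i; rewrite !inE => /andP[+ iS].
  rewrite iS /= -leqNgt => le.
  rewrite odd_reduceE le; have : R 0 mid <= R 0 (lift mid i).
    by apply: RS; rewrite /= /bump val_mid le; lia.
  by rewrite mid_score /=; move: lek; move: #|S| (R 0 _) => k a; lia.
rewrite [\sum_(i in S) _](big_setID U) /= (setIidPr US).
move: (\sum_(i in U) _) (\sum_(i in _) _) => a b.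
exact: add_large_scores_landau.
Qed.

Lemma odd_extendE (T : 'M[int]_n) :
  [/\ forall i j, odd_extend T (lift mid i) (lift mid j) = T i j,
      forall j, odd_extend T mid j = (j < n./2)%N%:R
    & forall i, odd_extend T i mid = (n./2 < i)%N%:R].
Proof.
split=> [i j | j | i]; rewrite mxE -/mid.
- by rewrite !liftK.
- by rewrite unlift_none.
- rewrite unlift_none; case: unliftP => [k _ // | ->].
  by rewrite val_mid ltnn.
Qed.

Lemma odd_extend_class (T : 'M[int]_n) :
  hankel_class (odd_reduce R) T -> hankel_class R (odd_extend T).
Proof.
case=> -[[T01 T0 TC] TH] TS.
have [Ell Em Ejm] := odd_extendE T.
split; [split; first split|].
- move=> i j; case: (unliftP mid i) => [i'|] ->; last by rewrite Em; case: ltnP.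
  case: (unliftP mid j) => [j'|] ->; last by rewrite Ejm; case: ltnP.
  by rewrite Ell.
- move=> i; case: (unliftP mid i) => [i'|] ->; first by rewrite Ell.
  by rewrite Em val_mid ltnn.
- have mE (x : 'I_n.+1) : x != mid -> (x < n./2)%N = ~~ (n./2 < x)%N.
    by rewrite -(inj_eq val_inj) /= val_mid; lia.
  move=> i j; case: (unliftP mid i) => [i'|] ->; last first.
    by rewrite eq_sym Em Ejm => /mE->; case: ltnP.
  case: (unliftP mid j) => [j'|] ->; last first.
    by rewrite Em Ejm => /mE->; case: ltnP.
  by move=> ij; rewrite !Ell TC //; apply: contra ij => /eqP->.
- apply/matrixP => i j; rewrite mxE; case: (unliftP mid i) => [i'|] ->; last first.
    by rewrite rev_mid Em Ejm /=; congr ((nat_of_bool _)%:R); have := ltn_ord j; move: nE; lia.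
  case: (unliftP mid j) => [j'|] ->; last first.
    rewrite rev_mid Em Ejm; congr ((nat_of_bool _)%:R).
    by move: (lift mid i') nE => [x ltx] /=; clear -ltx; lia.
  by rewrite !rev_lift_mid !Ell -[in RHS]TH mxE.
apply/rowP => i; rewrite mxE; case: (unliftP mid i) => [i'|] ->; last first.
  under eq_bigr => j _ do rewrite Em.
  by rewrite sum_prefix ?mid_score //; lia.
rewrite (bigD1_ord mid) //= Ejm.
under eq_bigr => j _ do rewrite Ell.
have /rowP/(_ i') := TS; rewrite mxE odd_reduceE => ->.
have -> : (n./2 < lift mid i')%N = (n./2 <= i')%N.
  by rewrite /= /bump val_mid; case: leqP; lia.
ring.
Qed.

End OddStep.

(** * The algorithm *)

Lemma hankel_input_succeeds n (R : 'rV[int]_n) :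
  hankel_input R -> hankel_succeeds R.
Proof.
elim/ltn_ind: n R => -[|n] IHn R RI; first exact: Succeeds0.
have [nO | nE] := boolP (odd n); last first.
  have RC := odd_reduce_complementary nE RI; have RL := odd_reduce_landau nE RI.
  apply: SucceedsOdd => // [|q qS]; first exact: sorting_perm_exists.
  by apply: IHn => //; apply: sorted_hankel_input.
case: n nO IHn R RI => // n nE IHn R RI.
have RC := even_reduce_complementary RI; have RL := even_reduce_landau RI nE.
apply: SucceedsEven => // [|q qS]; first exact: sorting_perm_exists.
by apply: IHn => //; apply: sorted_hankel_input.
Qed.

Lemma hankel_succeeds_output n (R : 'rV[int]_n) :
  hankel_succeeds R -> exists T, hankel_output R T.
Proof.
elim=> {n R} [R _ | n R nE _ [q qS] _ IH | n R nE _ [q qS] _ IH].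
- by exists 0; apply: Output0.
- by have [T HT] := IH q qS; eexists; apply: OutputEven HT.
- by have [T HT] := IH q qS; eexists; apply: OutputOdd HT.
Qed.

Lemma hankel_output_class n (R : 'rV[int]_n) (T : 'M[int]_n) :
  hankel_output R T -> hankel_input R -> hankel_class R T.
Proof.
elim=> {n R T} [R T _ | n R q T nE qS _ IH RI | n R q T nE qS _ IH RI].
- by split; [split; [split=> -[] | apply/matrixP => -[]] | apply/rowP => -[]].
- apply: even_extend_class => //; apply: unsorted_hankel_class => //; first by case: qS.
  apply: IH; apply: sorted_hankel_input => //.
    exact: even_reduce_complementary.
  exact: even_reduce_landau.
- apply: odd_extend_class => //; apply: unsorted_hankel_class => //; first by case: qS.
  apply: IH; apply: sorted_hankel_input => //.
    exact: odd_reduce_complementary.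
  exact: odd_reduce_landau.
Qed.

Unset Implicit Arguments.

Theorem theorem14 (n : nat) (R : 'rV[int]_n)
  (nonneg : forall i : 'I_n, 0 <= R 0 i)
  (nondecreasing : forall i j : 'I_n, (i <= j)%N -> R 0 i <= R 0 j)
  (complementary : forall i : 'I_n, R 0 i + R 0 (rev_ord i) = n%:Z - 1)
  (landau : forall k : nat, (1 <= k <= n)%N ->
     'C(k, 2)%:Z <= \sum_(i < n | (i < k)%N) R 0 i)
  (landau_eq : \sum_(i < n) R 0 i = 'C(n, 2)%:Z) :
  [/\ hankel_succeeds R,
      exists T : 'M[int]_n, hankel_output R T
    & forall T : 'M[int]_n, hankel_output R T -> hankel_class R T].
Proof.
have RI : hankel_input R by split.
have Rok := hankel_input_succeeds RI.
split=> // [|T RT]; first exact: hankel_succeeds_output.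
exact: hankel_output_class RT RI.
Qed.
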